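(* Let $d \ge 1$ and $t \ge 2$ be fixed integers. If $H$ is a fixed $d$-uniform hypergraph with at least two edges in which all edges are pairwise disjoint, then $\operatorname{ex}_{d+1}(n, K_{H,t}) = O(n^{d+1-1/t})$.
   Context: All hypergraphs are finite. A $d$-uniform hypergraph is one all of whose edges are $d$-element subsets of the vertex set (for $d=1$ the edges are singletons). A hypergraph is $H$-free if it contains no (not necessarily induced) subhypergraph isomorphic to $H$. For a $d$-uniform hypergraph $H$, $\operatorname{ex}_d(n,H)$ denotes the maximum number of edges in an $H$-free $d$-uniform hypergraph on $n$ vertices. For a $d$-uniform hypergraph $H$ and a positive integer $t$, $K_{H,t}$ is the $(d+1)$-uniform hypergraph obtained from $H$ by adding $t$ new vertices $v_1,\dots,v_t$ and replacing every edge $e \in E(H)$ with the $t$ edges $e\cup\{v_1\},\dots,e\cup\{v_t\}$. Asymptotic notation is as $n\to\infty$ with $d$, $t$, $H$ fixed; implied constants may depend on these fixed parameters. *)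

(* Defs.v *)
From mathcomp Require Import all_boot.

Set Implicit Arguments.
Unset Strict Implicit.
Unset Printing Implicit Defensive.

Record hypergraph : Type := Hypergraph {
  vertex :> finType;
  edges : {set {set vertex}}
}.

Definition hg_uniform (d : nat) (H : hypergraph) : bool :=
  [forall e in edges H, #|e| == d].

Definition disjoint_edges (H : hypergraph) : Prop :=
  forall e f, e \in edges H -> f \in edges H -> e != f -> [disjoint e & f].

(* An injective f mapping edges to edges is an isomorphism from H onto the
   (not necessarily induced) subhypergraph of G whose vertices are the f x
   and whose edges are the f @: e. *)
Definition is_copy (H G : hypergraph) (f : {ffun H -> G}) : bool :=
  injectiveb f && [forall e in edges H, f @: e \in edges G].

Definition hg_free (H G : hypergraph) : bool :=
  ~~ [exists f : {ffun H -> G}, is_copy f].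

(* Every hypergraph on n vertices is isomorphic to one on 'I_n.  The maximum
   over an empty family is 0; the family contains the edgeless hypergraph as
   soon as H has an edge. *)
Definition ex_number (d n : nat) (H : hypergraph) : nat :=
  \max_(E : {set {set 'I_n}}
        | hg_uniform d (Hypergraph E) && hg_free H (Hypergraph E)) #|E|.

(* K_{H,t}: the new vertices v_1, ..., v_t are the inr i with i : 'I_t. *)
Definition KHt (H : hypergraph) (t : nat) : hypergraph :=
  @Hypergraph (H + 'I_t)%type
    [set inr i |: [set inl x | x in e] | e : {set H} in edges H, i : 'I_t].

(* Main.v *)
(** Count pairs (e, f) where e is a d-set of vertices and f maps 'I_t to the
    neighbours of e.  For injective f the admissible e form a hypergraph that,
    for n large, has no #|edges H| pairwise disjoint edges, hence has
    O(n ^ (d - 1)) edges; and only O(n ^ (t - 1)) maps f are not injective.  So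
    the t-th powers of the degrees of the d-sets sum to O(n ^ (d + t - 1)), and
    a <= x + a ^ t / x ^ (t - 1) with x = n ^ (1 - 1 / t) bounds the sum of the
    degrees. *)
Require Import Defs.
From mathcomp Require Import all_boot.
From mathcomp Require Import zify ring.
Set Implicit Arguments.
Unset Strict Implicit.

(** * Falling factorials and binomial coefficients *)

Lemma leq_ffact_expn (n k : nat) : n ^_ k <= n ^ k.
Proof.
elim: k => [|k IHk]; first by rewrite ffactn0 expn0.
by rewrite ffactnSr expnSr leq_mul // leq_subr.
Qed.

Lemma leq_bin_expn (n k : nat) : 'C(n, k) <= n ^ k.
Proof.
apply: leq_trans (leq_ffact_expn n k).
by rewrite -bin_ffact leq_pmulr ?fact_gt0.
Qed.

(** The difference [n ^ k.+1 - n ^_ k.+1] counts the non-injective maps from a set of size [k.+1] to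
    one of size [n]. The square survives the induction because [k.+1 + k.+1 ^ 2 <= k.+2 ^ 2]. *)
Lemma leq_expn_ffact (n k : nat) :
  n ^ k.+1 <= n ^_ k.+1 + k.+1 ^ 2 * n ^ k.
Proof.
elim: k => [|k IHk]; first by rewrite ffactn1 expn1 leq_addr.
rewrite ffactnSr (expnS n k.+1).
apply: leq_trans (leq_mul (leqnn n) IHk) _.
have le_F := leq_ffact_expn n k.+1.
rewrite (expnS n k) in le_F *.
have leF2: n * n ^_ k.+1 <= n ^_ k.+1 * (n - k.+1) + k.+1 * n ^_ k.+1.
  by rewrite (mulnC k.+1) -mulnDr mulnC leq_mul //; lia.
have := leq_mul (leqnn k.+1) le_F.
nia.
Qed.

(** * Injections and matchings in uniform set systems *)

Lemma inj_into (T U : finType) (u0 : U) (A : {set T}) (B : {set U}) :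
  #|A| <= #|B| ->
  exists h : T -> U, {in A &, injective h} /\ {in A, forall x, h x \in B}.
Proof.
move=> leAB; exists (fun x => nth u0 (enum B) (index x (enum A))).
have ltB x : x \in A -> index x (enum A) < size (enum B).
  by move=> Ax; rewrite -cardE (leq_trans _ leAB) // cardE index_mem mem_enum.
split=> [x y Ax Ay /eqP|x Ax].
  rewrite nth_uniq ?enum_uniq ?ltB // => /eqP eq_idx.
  rewrite -(nth_index x (_ : x \in enum A)) ?mem_enum // eq_idx.
  by rewrite nth_index ?mem_enum.
by rewrite -mem_enum mem_nth ?ltB.
Qed.

Lemma card_cover_uniform (T : finType) (P : {set {set T}}) (k : nat) :
  trivIset P -> {in P, forall e : {set T}, #|e| = k} ->
  #|cover P| = #|P| * k.
Proof.
by move=> tP cP; rewrite -(eqP tP) (eq_bigr (fun=> k)) // sum_nat_const.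
Qed.

Lemma card_draws_mem (T : finType) (x : T) (d : nat) :
  #|[set e : {set T} | #|e| == d.+1 & x \in e]| <= #|T| ^ d.
Proof.
rewrite -(card_in_imset (f := fun e : {set T} => e :\ x)); last first.
  move=> e f; rewrite !inE => /andP[_ xe] /andP[_ xf] eq_ef.
  by rewrite -(setD1K xe) eq_ef setD1K.
apply: leq_trans (leq_bin_expn _ d); rewrite -card_draws.
apply/subset_leq_card/subsetP=> _ /imsetP[e + ->]; rewrite !inE.
by case/andP=> /eqP ce xe; have := cardsD1 x e; rewrite xe ce add1n => -[<-].
Qed.

(* A maximal matching in L with fewer than s edges has a vertex set of size
   less than s * d.+1 that meets every member of L. *)
Lemma matching_or_few (T : finType) (d s : nat) (L : {set {set T}}) :
  {in L, forall e : {set T}, #|e| = d.+1} ->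
  (exists M : {set {set T}}, [/\ M \subset L, trivIset M & #|M| = s])
  \/ #|L| <= s * d.+1 * #|T| ^ d.
Proof.
move=> cL; elim: s => [|s [[M [sML tM cM]]|few]]; last 1 first.
- by right; apply: leq_trans few _; rewrite leq_mul // leq_mul.
- left; exists set0.
  by rewrite sub0set cards0 /trivIset /cover !big_set0 cards0.
have cMd : {in M, forall e : {set T}, #|e| = d.+1}.
  by move=> e Me; apply/cL/(subsetP sML).
have [/existsP[e /andP[Le dis]]|no_ext] :=
  boolP [exists e, (e \in L) && [disjoint e & cover M]].
  left; exists (e |: M).
  (* A member of [M] lies inside [cover M], so it could avoid [cover M] only by being empty. *)
  have nMe : e \notin M.
    apply/negP=> Me; have: e \subset cover M by exact: bigcup_sup.
    move=> /setIidPl eIM; move: dis; rewrite -setI_eq0 eIM => /eqP e0.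
    by have := cL e Le; rewrite e0 cards0.
  split; last by rewrite cardsU1 nMe cM.
    by rewrite subUset sub1set Le sML.
  apply/trivIsetP=> A B /setU1P[->|MA] /setU1P[->|MB] neqAB.
  - by rewrite eqxx in neqAB.
  - by apply: disjointWr dis; apply: bigcup_sup.
  - by rewrite disjoint_sym; apply: disjointWr dis; apply: bigcup_sup.
  - exact: (trivIsetP tM).
right; apply: (@leq_trans (\sum_(x in cover M) #|T| ^ d)); last first.
  by rewrite sum_nat_const leq_mul // (card_cover_uniform tM cMd) cM leq_mul.
apply: (@leq_trans
  #|\bigcup_(x in cover M) [set e : {set T} | #|e| == d.+1 & x \in e]|).
  apply/subset_leq_card/subsetP=> e Le.
  have := negP no_ext.
  have [dis []|/pred0Pn[x /andP[xe xM]] _] := boolP [disjoint e & cover M].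
    by apply/existsP; exists e; rewrite Le.
  by apply/bigcupP; exists x => //; rewrite inE cL // eqxx.
have leU (I : {set T}) (F : T -> {set {set T}}) :
    #|\bigcup_(x in I) F x| <= \sum_(x in I) #|F x|.
  elim/big_ind2: _ => // [|A a B b leA leB]; first by rewrite cards0.
  by rewrite (leq_trans (leq_card_setU a b)) ?leq_add.
by apply: leq_trans (leU _ _) _; apply: leq_sum => x _; apply: card_draws_mem.
Qed.

(** * Building a copy of [KHt H t] *)

(* The bound #|H| + t <= n leaves room for the isolated vertices of H. *)
Lemma KHt_copy (d t n : nat) (H : hypergraph) (E M : {set {set 'I_n}})
    (f : 'I_t -> 'I_n) :
  hg_uniform d.+1 H -> disjoint_edges H -> #|H| + t <= n ->
  0 < #|edges H| ->
  trivIset M -> #|M| = #|edges H| ->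
  {in M, forall e : {set 'I_n}, #|e| = d.+1} ->
  injective f ->
  {in M, forall e : {set 'I_n}, forall i, f i |: e \in E /\ f i \notin e} ->
  ~~ hg_free (KHt H t) (Hypergraph E).
Proof.
move=> Hu Hd le_n H0 tM cM Mu inj_f fM; rewrite negbK.
have cH : {in edges H, forall e : {set H}, #|e| = d.+1}.
  by move=> e He; apply/eqP; move/forall_inP: Hu; apply.
have tH : trivIset (edges H) by apply/trivIsetP=> A B; apply: Hd.
have [e0 He0] := card_gt0P H0.
have /card_gt0P[x0 _] : 0 < #|e0| by rewrite cH.
have n_gt0 : 0 < n by apply: leq_trans le_n; rewrite addn_gt0 (cardD1 x0).
pose u0 := Ordinal n_gt0.
have [phi [inj_phi Mphi]] :
    exists phi : {set H} -> {set 'I_n}, {in edges H &, injective phi} /\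
      {in edges H, forall e, phi e \in M}.
  by apply: (inj_into set0); rewrite cM.
(* Each edge [e] is mapped injectively into its block [phi e]; for other sets the constant map to
   [u0] is a dummy value. *)
have /fin_all_exists[h Hh] (e : {set H}) : exists h : H -> 'I_n,
    e \in edges H -> {in e &, injective h} /\ {in e, forall x, h x \in phi e}.
  have [He|nHe] := boolP (e \in edges H); last by exists (fun=> u0).
  have [|h Ph] := @inj_into H _ u0 e (phi e); last by exists h.
  by rewrite cH // Mu // Mphi.
pose F := [set f i | i : 'I_t].
have cF : #|F| = t by rewrite card_imset // card_ord.
have F_M : [disjoint F & cover M].
  apply/pred0P=> y /=; apply/andP=> -[/imsetP[i _ ->] /bigcupP[e Me]].
  by apply/negP; case: (fM e Me i).
(* Vertices in no edge go outside [cover M] and [F]. Both covers have [#|edges H| * d.+1] points, so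
   [#|H| + t <= n] leaves enough room. *)
have [h0 [inj_h0 Rh0]] : exists h0 : H -> 'I_n,
    {in ~: cover (edges H) &, injective h0} /\
    {in ~: cover (edges H), forall x, h0 x \in ~: (cover M :|: F)}.
  apply: (inj_into u0).
  have := cardsC (cover (edges H)); have := cardsC (cover M :|: F).
  rewrite cardsU disjoint_setI0 1?disjoint_sym // cards0 cF card_ord.
  rewrite (card_cover_uniform tM Mu) (card_cover_uniform tH cH) cM.
  rewrite subn0 => eq_n eq_H.
  by rewrite -(leq_add2l (#|edges H| * d.+1 + t)) {1}addnAC eq_H eq_n.
(* The edge through a covered [x] is unique by disjointness; [pblock] recovers it, which glues the
   maps [h e] together. *)
pose g x := if x \in cover (edges H) then h (pblock (edges H) x) x else h0 x.
have gE e x : e \in edges H -> x \in e -> g x = h e x.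
  move=> He xe; rewrite /g (def_pblock tH He xe).
  by rewrite (subsetP (bigcup_sup e He)).
have gM x : x \in cover (edges H) -> g x \in cover M.
  case/bigcupP=> e He xe; rewrite (gE e) //; apply/bigcupP.
  by exists (phi e); [exact: Mphi | case: (Hh e He) => _; apply].
have gN x : x \notin cover (edges H) -> g x \in ~: (cover M :|: F).
  by move=> nx; rewrite /g (negPf nx) Rh0 // inE.
have gF x : g x \notin F.
  have [/gM xM|/gN] := boolP (x \in cover (edges H)).
    by apply/negP=> xF; rewrite (disjointFr F_M xF) in xM.
  by rewrite !inE negb_or => /andP[].
have inj_g : injective g.
  move=> x y; have [xH|xH] := boolP (x \in cover (edges H));
    have [yH|yH] := boolP (y \in cover (edges H)).
  - have /bigcupP[e He xe] := xH; have /bigcupP[e' He' ye'] := yH.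
    rewrite (gE e) // (gE e') // => eq_h.
    have [inj_h hphi] := Hh e He; have [_ hphi'] := Hh e' He'.
    (* The common image lies in both [phi e] and [phi e'], and distinct blocks of [M] are
       disjoint. *)
    have eq_e : e = e'.
      apply: inj_phi => //.
      rewrite -(def_pblock tM (Mphi e He) (hphi x xe)) eq_h.
      by rewrite (def_pblock tM (Mphi e' He') (hphi' y ye')).
    by subst e'; apply: inj_h.
  - by move=> eq_g; have := gM x xH; have := gN y yH; rewrite eq_g !inE negb_or;
      case/andP=> /negPf->.
  - by move=> eq_g; have := gM y yH; have := gN x xH; rewrite eq_g !inE negb_or;
      case/andP=> /negPf->.
  - by rewrite /g (negPf xH) (negPf yH); apply: inj_h0; rewrite inE.
pose G : {ffun KHt H t -> Hypergraph E} :=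
  [ffun z : H + 'I_t => match z with inl x => g x | inr i => f i end].
apply/existsP; exists G; apply/andP; split.
  apply/injectiveP=> -[x|i] [y|j]; rewrite !ffunE => eq_G.
  - by rewrite (inj_g _ _ eq_G).
  - by case/negP: (gF x); rewrite eq_G imset_f.
  - by case/negP: (gF y); rewrite -eq_G imset_f.
  - by rewrite (inj_f _ _ eq_G).
apply/forall_inP=> _ /imset2P[e i He _ ->] /=.
have -> : G @: (inr i |: [set inl x | x in e]) = f i |: phi e.
  rewrite imsetU1 ffunE -imset_comp; congr (_ |: _).
  have [inj_h hphi] := Hh e He.
  rewrite (eq_in_imset (g := h e)); last first.
    by move=> x xe; rewrite /= ffunE (gE e).
  (* An injection from [e] into a set of the same size is onto. *)
  apply/eqP; rewrite eqEcard; apply/andP; split.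
    by apply/subsetP=> _ /imsetP[x xe ->]; apply: hphi.
  by rewrite card_in_imset // cH // Mu // Mphi.
by have [] := fM _ (Mphi e He) i.
Qed.

(** * Double counting of degrees *)

(** Each edge [e] equals [v |: (e :\ v)] for any [v] in it, so the pairs counted on the right map
    onto [E]. *)
Lemma edges_leq_sum_degree (T : finType) (d : nat) (E : {set {set T}}) :
  {in E, forall e : {set T}, #|e| = d.+1} ->
  #|E| <= \sum_(e : {set T} | #|e| == d) #|[set v | v |: e \in E]|.
Proof.
move=> cE.
pose P := [set p : {set T} * T | (#|p.1| == d) && (p.2 |: p.1 \in E)].
have -> : \sum_(e : {set T} | #|e| == d) #|[set v | v |: e \in E]| = #|P|.
  rewrite -[RHS]sum1dep_card.
  rewrite -(pair_big_dep (fun e : {set T} => #|e| == d)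
    (fun e v => v |: e \in E) (fun _ _ => 1)) /=.
  by apply: eq_bigr => e _; rewrite sum1dep_card.
apply: leq_trans (leq_imset_card (fun p => p.2 |: p.1) P).
apply/subset_leq_card/subsetP=> e Ee; apply/imsetP.
have /card_gt0P[v ve] : 0 < #|e| by rewrite cE.
exists (e :\ v, v); last by rewrite /= setD1K.
rewrite inE /= setD1K // Ee andbT.
by have := cardsD1 v e; rewrite ve cE // add1n => -[<-].
Qed.

(** The two summands of the constant come from the injective and the non-injective maps [f]. For
    injective [f], a matching of size [#|edges H|] in [L f] would yield a copy of [KHt H t.+1]. *)
Lemma sum_degree_pow (d t n : nat) (H : hypergraph) (E : {set {set 'I_n}}) :
  hg_uniform d.+1 H -> disjoint_edges H -> 0 < #|edges H| ->
  #|H| + t.+1 <= n ->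
  {in E, forall e : {set 'I_n}, #|e| = d.+2} ->
  hg_free (KHt H t.+1) (Hypergraph E) ->
  \sum_(e : {set 'I_n} | #|e| == d.+1) #|[set v | v |: e \in E]| ^ t.+1
    <= (#|edges H| * d.+1 + t.+1 ^ 2) * n ^ (d + t.+1).
Proof.
move=> Hu Hd H0 le_n cE freeE.
pose L (f : {ffun 'I_t.+1 -> 'I_n}) :=
  [set e : {set 'I_n} | (#|e| == d.+1) && [forall i, f i |: e \in E]].
have -> : \sum_(e : {set 'I_n} | #|e| == d.+1) #|[set v | v |: e \in E]| ^ t.+1
    = \sum_(f : {ffun 'I_t.+1 -> 'I_n}) #|L f|.
  under [RHS]eq_bigr do rewrite -sum1dep_card.
  rewrite (exchange_big_dep (fun e : {set 'I_n} => #|e| == d.+1)) /=;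
    last by move=> f e _ /andP[].
  apply: eq_bigr => e ce.
  (* The power of the degree counts the maps from ['I_t.+1] into the neighbourhood of [e]. *)
  rewrite sum1dep_card -[t.+1 in LHS]card_ord -card_ffun_on.
  apply: eq_card => f; rewrite [RHS]inE ce /=.
  by apply/ffun_onP/forallP=> Pf i; move: (Pf i); rewrite inE.
rewrite (bigID (fun f : {ffun 'I_t.+1 -> 'I_n} => injectiveb f)) /= mulnDl.
rewrite leq_add //.
  apply: (@leq_trans (\sum_(f : {ffun 'I_t.+1 -> 'I_n} | injectiveb f)
                        #|edges H| * d.+1 * n ^ d)).
    apply: leq_sum => f /injectiveP inj_f.
    have cL : {in L f, forall e : {set 'I_n}, #|e| = d.+1}.
      by move=> e; rewrite inE => /andP[/eqP].
    have [[M [sML tM cM]]|] := matching_or_few #|edges H| cL; last first.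
      by rewrite card_ord.
    have /negP[//] : ~~ hg_free (KHt H t.+1) (Hypergraph E).
    apply: (KHt_copy (f := f) Hu Hd le_n H0 tM cM) => // e /(subsetP sML) Le.
      exact: cL.
    (* If [f i] were in [e], then [f i |: e] would be [e], of size [d.+1] and not [d.+2]. *)
    move=> i; move: Le; rewrite inE => /andP[/eqP ce /forallP/(_ i) fE].
    split=> //; have := cE _ fE; rewrite cardsU1 ce.
    by case: (f i \notin e) => // /n_Sn.
  rewrite sum_nat_cond_const card_inj_ffuns !card_ord.
  rewrite mulnC -mulnA leq_mul // expnD leq_mul //.
  exact: leq_ffact_expn.
(* For non-injective [f] the trivial bound on [L f] suffices, as there are at most
   [t.+1 ^ 2 * n ^ t] such maps. *)
apply: (@leq_trans
  (\sum_(f : {ffun 'I_t.+1 -> 'I_n} | ~~ injectiveb f) n ^ d.+1)).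
  apply: leq_sum => f _; apply: leq_trans (leq_bin_expn n d.+1).
  rewrite -[n in 'C(n, _)]card_ord -card_draws.
  by apply/subset_leq_card/subsetP=> e; rewrite !inE => /andP[].
rewrite sum_nat_cond_const addnS -addSn expnD (mulnC (n ^ _)) mulnA leq_mul //.
(* Adding the number of injective maps reduces the claim to [leq_expn_ffact]. *)
rewrite -(leq_add2l (n ^_ t.+1)).
have := cardsC [set f : {ffun 'I_t.+1 -> 'I_n} | injectiveb f].
rewrite card_inj_ffuns card_ffun !card_ord => eq_c.
apply: leq_trans (leq_expn_ffact n t); rewrite -eq_c leq_add2l.
by apply/subset_leq_card/subsetP=> f; rewrite !inE.
Qed.

(* Real exponents and the final estimate *)
From mathcomp Require Import all_order all_algebra.
From mathcomp Require Import all_classical all_reals all_analysis.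
Import Order.TTheory GRing.Theory Num.Theory.
Import numFieldNormedType.Exports.
Local Open Scope classical_set_scope.
Local Open Scope ring_scope.

(** If [a <= x] the first term suffices; otherwise [(a / x) ^+ k >= 1] and the second term is at
    least [a]. *)
Lemma le_add_expr_div (R : realFieldType) (a x : R) (k : nat) :
  0 <= a -> 0 < x -> a <= x + a ^+ k.+1 / x ^+ k.
Proof.
move=> a_ge0 x_gt0; have [le_ax|lt_xa] := leP a x.
  by rewrite (le_trans le_ax) // lerDl divr_ge0 ?exprn_ge0 // ltW.
rewrite -[leLHS]add0r lerD ?(ltW x_gt0) // ler_pdivlMr ?exprn_gt0 //.
by rewrite exprS ler_wpM2l // lerXn2r ?nnegrE ?(ltW x_gt0) // ltW.
Qed.

(** A substitute for the power mean inequality, with the threshold [x] left free to be optimised. *)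
Lemma sumr_le_expr (R : realFieldType) (I : finType) (P : pred I)
    (a : I -> nat) (x : R) (k : nat) :
  0 < x ->
  (\sum_(i | P i) a i)%:R
    <= #|P|%:R * x + (\sum_(i | P i) a i ^ k.+1)%:R / x ^+ k.
Proof.
move=> x_gt0; rewrite !natr_sum mulr_suml mulr_natl -sumr_const -big_split /=.
by apply: ler_sum => i _; rewrite natrX le_add_expr_div.
Qed.

Lemma ex_number_KHt_le (R : realType) (d t n : nat) (H : hypergraph) :
  hg_uniform d.+1 H -> disjoint_edges H -> (0 < #|edges H|)%N ->
  (#|H| + t.+1 <= n)%N ->
  (ex_number (d.+1 + 1) n (KHt H t.+1))%:R
    <= (1 + (#|edges H| * d.+1 + t.+1 ^ 2)%:R)
       * n%:R `^ (d.+1%:R + 1 - 1 / t.+1%:R) :> R.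
Proof.
move=> Hu Hd H0 le_n; have n_gt0 : (0 < n)%N by lia.
set K := (_ + _ ^ 2)%N; set y := _ `^ _.
have n0 : n%:R != 0 :> R by rewrite pnatr_eq0 -lt0n.
have powD r s : n%:R `^ (r + s) = n%:R `^ r * n%:R `^ s :> R.
  by rewrite powRD // n0 implybT.
rewrite /ex_number; elim/big_ind: _ => [|p q le_p le_q|E /andP[Eu freeE]].
- by rewrite mulr_ge0 ?powR_ge0 // addr_ge0.
- by rewrite /maxn; case: ifP.
have cE : {in E, forall e : {set 'I_n}, #|e| = d.+2}.
  by move=> e Ee; move/forall_inP: Eu => /(_ e Ee)/eqP; rewrite addn1.
(* This [x] balances the two terms: [n ^ d.+1 * x] and [n ^ (d + t.+1) / x ^ t] both equal [y]. *)
pose x : R := n%:R `^ (1 - 1 / t.+1%:R).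
have x_gt0 : 0 < x by rewrite powR_gt0 // ltr0n.
have := edges_leq_sum_degree cE; rewrite -(ler_nat R) => /le_trans; apply.
apply: le_trans (sumr_le_expr _ _ t x_gt0) _.
rewrite mulrDl mul1r lerD //.
  rewrite /y -addrA powD ler_pM2r // powR_mulrn // -natrX ler_nat -cardsE.
  by rewrite card_draws card_ord leq_bin_expn.
rewrite ler_pdivrMr ?exprn_gt0 //.
apply: (@le_trans _ _ (K * n ^ (d + t.+1))%:R).
  by rewrite ler_nat sum_degree_pow.
rewrite natrM -mulrA ler_wpM2l //.
rewrite natrX -(powR_mulrn _ (ler0n R n)) -(powR_mulrn t (ltW x_gt0)).
rewrite -powRrM -powD.
(* Equality holds: the exponents agree since [(1 + t) / t.+1 = 1]. *)
rewrite le_eqVlt; apply/orP; left; apply/eqP; congr (_ `^ _).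
rewrite !natrD -[t.+1]addn1 -[d.+1]addn1 !natrD.
have t0 : t%:R + 1%:R != 0 :> R by rewrite -natrD pnatr_eq0 addn1.
by field.
Qed.

Theorem corollary2p4 (R : realType) (d t : nat) (H : hypergraph)
    (hd : (1 <= d)%N) (ht : (2 <= t)%N)
    (H_uniform : hg_uniform d H)
    (H_edges : (2 <= #|edges H|)%N)
    (H_disjoint : disjoint_edges H) :
  (fun n : nat => (ex_number (d + 1) n (KHt H t))%:R : R^o)
    =O_\oo (fun n : nat => n%:R `^ (d%:R + 1 - 1 / t%:R) : R^o).
Proof.
case: d hd H_uniform => // d _ Hu; case: t ht => // t _.
apply/eqO_exP.
exists (1 + (#|edges H| * d.+1 + t.+1 ^ 2)%:R); first by rewrite ltr_pwDl.
(* From this threshold on there is room to embed [KHt H t.+1]. *)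
exists (#|H| + t.+1)%N => //= n le_n.
rewrite (ger0_norm (ler0n _ _)) (ger0_norm (powR_ge0 _ _)).
by apply: ex_number_KHt_le => //; apply: ltnW.
Qed.
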